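(* Suppose that $(u_n)_{n\ge 1}$ is a square computable sequence in $\mathbb{R}$, and $(\varepsilon_n)$ is an algorithmically random Rademacher sequence. Then $\sum_{n=1}^{\infty} \varepsilon_n u_n$ converges in $\mathbb{R}$.
   Context: Write $\mathcal{N}=\{-1,1\}^{\omega}$ for the space of infinite sequences of $\pm1$. For $\alpha\in\mathcal{N}$ let $\overline{\alpha}(n)$ be its initial segment of length $n$. $K$ denotes (prefix-free, i.e. self-delimiting) Kolmogorov complexity of finite strings. A sequence $\alpha\in\mathcal{N}$ is Kolmogorov-Chaitin complex if there is $k$ such that $K(\overline{\alpha}(n))\ge n-k$ for all $n$; the set of such $\alpha$ is denoted $KC$. A sequence $(\varepsilon_n)$ is an algorithmically random Rademacher sequence if there is some $\alpha\in KC$ such that $\varepsilon_n\in\{-1,1\}$ is the $n$th bit of $\alpha$ for every $n$. A sequence $(x_n)$ of real numbers is a computable sequence if there is an effective way of approximating $x_n$ arbitrarily closely, given $n$. A computable sequence of real numbers $(x_n)$ is square computable if there is an effective procedure for determining the sum $\sum_{k=1}^{\infty}x_k^2$ to arbitrary accuracy from $(x_n)$; that is, given a positive integer $m$, there is an effective procedure for finding $n=n(m)$ such that $\left|\sum_{k=1}^{\infty}x_k^2-\sum_{k=1}^{n}x_k^2\right|<1/m$ (in particular the infinite sum is finite). *)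

(* Defs.v *)
From mathcomp Require Import all_boot all_order all_algebra.
From mathcomp Require Import all_classical all_reals all_analysis.
Import Order.TTheory GRing.Theory Num.Theory.
Import numFieldNormedType.Exports.

Set Implicit Arguments.
Unset Strict Implicit.
Unset Printing Implicit Defensive.

Local Open Scope classical_set_scope.
Local Open Scope ring_scope.

(* Throughout, sequences are indexed from 0: the term written [x n] here is
   the (n+1)-st term of a sequence that starts at index 1, so that
   [series x n] and [mkseq x n] are the first n terms. *)

(* Kleene's mu-recursive functions of n arguments. *)
Inductive recf : nat -> Type :=
| RZero n : recf n
| RSucc : recf 1
| RProj n : 'I_n -> recf n
| RComp k n : recf k -> ('I_k -> recf n) -> recf n
| RPrec n : recf n -> recf n.+2 -> recf n.+1
| RMu n : recf n.+1 -> recf n.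

Fixpoint prec_graph n (f : n.-tuple nat -> nat -> Prop)
    (g : n.+2.-tuple nat -> nat -> Prop) (m : nat) (v : n.-tuple nat)
    (y : nat) : Prop :=
  if m is m'.+1 then
    exists2 z, prec_graph f g m' v z & g (cons_tuple m' (cons_tuple z v)) y
  else f v y.

(* [eval e v y]: the partial function denoted by e is defined at v, with
   value y. The recursion argument of [RPrec] and the search argument of [RMu]
   come first. *)
Fixpoint eval n (e : recf n) : n.-tuple nat -> nat -> Prop :=
  match e in recf n return n.-tuple nat -> nat -> Prop with
  | RZero _ => fun _ y => y = 0%N
  | RSucc => fun v y => y = (thead v).+1
  | RProj _ i => fun v y => y = tnth v i
  | RComp k _ f g => fun v y =>
      exists2 w : k.-tuple nat, forall i, eval (g i) v (tnth w i) & eval f w y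
  | RPrec _ f g => fun v y =>
      prec_graph (eval f) (eval g) (thead v) (behead_tuple v) y
  | RMu _ f => fun v y =>
      eval f (cons_tuple y v) 0%N /\
      forall i, (i < y)%N -> exists z, eval f (cons_tuple i v) z.+1
  end.

Definition computable1 (f : nat -> nat) : Prop :=
  exists e : recf 1, forall m, eval e [tuple m] (f m).

Definition computable2 (f : nat -> nat -> nat) : Prop :=
  exists e : recf 2, forall n m, eval e [tuple n; m] (f n m).

(* The letters -1 and 1 are represented by [false] and [true]. [code] is the
   bijection between strings and natural numbers given by bijective base 2,
   least significant digit first. *)
Definition code (s : bitseq) : nat :=
  foldr (fun (b : bool) n => n.*2 + b.+1)%N 0%N s.

Definition partial_computable (M : bitseq -> option bitseq) : Prop :=
  exists e : recf 1, forall p x, M p = Some x <-> eval e [tuple code p] (code x).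

Definition prefix_free_machine (M : bitseq -> option bitseq) : Prop :=
  partial_computable M /\ forall p q, M p -> M q -> prefix p q -> p = q.

(* The reference machines with respect to which K is defined. *)
Definition universal_machine (U : bitseq -> option bitseq) : Prop :=
  prefix_free_machine U /\
  forall M, prefix_free_machine M ->
    exists c : nat, forall p x, M p = Some x ->
      exists2 q, U q = Some x & (size q <= size p + c)%N.

(* The least length of a U-description of x. For a universal machine U every x
   has a description, so that the default value 0 is irrelevant. *)
Definition K (U : bitseq -> option bitseq) (x : bitseq) : nat :=
  xget 0%N [set l | (exists2 p, U p = Some x & size p = l) /\
                    forall p, U p = Some x -> (l <= size p)%N].

Definition KC (U : bitseq -> option bitseq) : set (nat -> bool) :=
  [set alpha | exists k : nat, forall n,
    n%:Z - k%:Z <= (K U (mkseq alpha n))%:Z].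

Definition random_rademacher (R : realType) (U : bitseq -> option bitseq)
    (eps : nat -> R) : Prop :=
  exists2 alpha, KC U alpha & forall n, eps n = if alpha n then 1 else -1.

Definition computable_rat2 (q : nat -> nat -> rat) : Prop :=
  exists a b c : nat -> nat -> nat,
    [/\ computable2 a, computable2 b, computable2 c &
        forall n m, q n m = ((a n m)%:R - (b n m)%:R) / (c n m).+1%:R].

Definition computable_sequence (R : realType) (x : nat -> R) : Prop :=
  exists2 q, computable_rat2 q &
    forall n m, (0 < m)%N -> `|x n - ratr (q n m)| < m%:R^-1.

Definition square_computable (R : realType) (x : nat -> R) : Prop :=
  let sq := series (fun k => x k ^+ 2) in
  [/\ computable_sequence x, cvgn sq &
      exists2 N : nat -> nat, computable1 N &
        forall m, (0 < m)%N -> `|limn sq - sq (N m)| < m%:R^-1].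

(* Main.v *)
Require Import Defs.
From mathcomp Require Import all_boot all_order all_algebra.
From mathcomp Require Import all_classical all_reals all_analysis.
From mathcomp Require Import zify ring lra.
Import Order.TTheory GRing.Theory Num.Theory.
Import numFieldNormedType.Exports.
Import Defs.
Local Open Scope classical_set_scope.
Local Open Scope ring_scope.

Set Implicit Arguments.
Unset Strict Implicit.
Unset Printing Implicit Defensive.

(** The argument turns a failure of convergence into short descriptions of
    initial segments of alpha.

    Cut the indices into blocks [cut j, cut j.+1), where cut is computable and
    the square sum of u beyond cut j is at most 1 / (4 * 16 ^ j); such cut points
    are available because u is square computable. Call block j bad for a sign
    sequence if some partial sum of the block exceeds about 2 ^- j. By
    Kolmogorov's maximal inequality ([signed_maximal_inequality]) at most a
    fraction 4 ^- j of all sign strings of length cut j.+1 makes block j bad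
    ([large_block_rare]). To make badness decidable, u is replaced on block j by
    integers close to scale j * u k, computed from the rational approximations;
    the scale grows so fast that the rounding costs another 2 ^- j at most
    ([weight_approx], [block_small]).

    A string of length n that is bad for block j can be described by j in unary
    followed by its rank among all bad strings of that length, written with
    n - 2 j bits. These n - j + 1 bits form a prefix-free code, because j
    determines the length of the whole description, and a machine decodes it by a
    search. So, for j large, the initial segments of a complex sequence are not
    bad ([rare_tests_eventually_pass]). Then the partial sums move by at most
    2 / 2 ^ j in block j, hence are a Cauchy sequence ([series_close]).

    That the decoding is recursive is shown with a small calculus of total
    recursive functions, closed under arithmetic, bounded sums and bounded
    search. Strings are handled through their codes: the code of s plus one is
    2 ^ size s plus the number whose binary digits are s, least significant digit
    first ([code_value]). *)

(** * Total recursive functions *)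

Section TotalFunctions.
Local Open Scope nat_scope.

(** The argument is a plain list rather than a tuple: the variables of a formula
    are then the entries [nth 0 v i], and going under a binder is [behead]. *)
Definition recursive n (f : seq nat -> nat) :=
  exists e : recf n, forall v : n.-tuple nat, eval e v (f v).

(** Computations are only known to be defined at a given value; uniqueness of the
    value is what allows to read off that value from a terminating search. *)
Lemma eval_functional n (e : recf n) v y y' :
  eval e v y -> eval e v y' -> y = y'.
Proof.
elim: e v y y' => {n}
    [n||n i|k n f IHf g IHg|n f IHf g IHg|n f IHf] v y y' /=.
- by move=> -> ->.
- by move=> -> ->.
- by move=> -> ->.
- move=> [w gw fw] [w' gw' fw'].
  have eqw : w = w' by apply: eq_from_tnth => i; apply: IHg (gw i) (gw' i).
  by apply: IHf fw _; rewrite eqw.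
- elim: (thead v) y y' => [|m IHm] y y' /=; first exact: IHf.
  move=> [z fz gz] [z' fz' gz']; rewrite (IHm _ _ fz fz') in gz.
  exact: IHg gz gz'.
- move=> [fy lty] [fy' lty']; case: (ltngtP y y') => // [/lty'|/lty] [z fz].
    by have := IHf _ _ _ fy fz.
  by have := IHf _ _ _ fy' fz.
Qed.

Lemma recursive_ext n f f' : recursive n f -> f =1 f' -> recursive n f'.
Proof. by move=> [e ef] eqf; exists e => v; rewrite -eqf. Qed.

Lemma recursive_comp n k (f : seq nat -> nat) (g : nat -> seq nat -> nat) :
    recursive k f -> (forall i, i < k -> recursive n (g i)) ->
  recursive n (fun v => f (mkseq (g^~ v) k)).
Proof.
move=> [e ef] cg.
have /choice[G Gg] : forall i : 'I_k, exists e' : recf n,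
    forall v : n.-tuple nat, eval e' v (g i v) by move=> i; exact: cg.
exists (RComp e G) => v /=.
exists (mktuple (fun i : 'I_k => g i v)) => [i|]; first by rewrite tnth_mktuple.
suff -> : mkseq (g^~ v) k = mktuple (fun i : 'I_k => g i v) by exact: ef.
by rewrite /mkseq -val_enum_ord -map_comp.
Qed.

Lemma recursive_nth n i : i < n -> recursive n (fun v => nth 0 v i).
Proof. by move=> ltin; exists (RProj (Ordinal ltin)) => v /=; rewrite (tnth_nth 0). Qed.

(** Weakening: a function of the outer variables stays recursive under a binder,
    which adds its variable at the head of the list. *)
Lemma recursive_behead n f : recursive n f ->
  recursive n.+1 (fun v => f (behead v)).
Proof.
move=> cf; have [|e ef] := recursive_comp (n := n.+1) (g := fun i v => nth 0 v i.+1) cf.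
  by move=> i ltin; apply: recursive_nth.
exists e => v; have := ef v; congr (eval _ _ (f _)).
apply: (@eq_from_nth _ 0) => [|i]; rewrite size_mkseq ?size_tuple// => ltin.
by rewrite nth_mkseq// nth_behead.
Qed.

Lemma recursive_app1 n h f : computable1 h -> recursive n f ->
  recursive n (fun v => h (f v)).
Proof.
move=> [e eh] cf.
have c1 : recursive 1 (fun v => h (nth 0 v 0)).
  by exists e => v; rewrite [v]tuple_eta/=; have := eh (thead v);
     congr eval; apply: val_inj; case: v => -[|x []].
by have := recursive_comp c1 (g := fun=> f) (fun=> fun=> cf).
Qed.

Lemma recursive_app2 n h f g :
  computable2 h -> recursive n f -> recursive n g -> recursive n (fun v => h (f v) (g v)).
Proof.
move=> [e eh] cf cg.
have c2 : recursive 2 (fun v => h (nth 0 v 0) (nth 0 v 1)).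
  exists e => v; have := eh (nth 0 v 0) (nth 0 v 1).
  by congr eval; apply: val_inj; case: v => -[|x [|y []]].
have := recursive_comp c2 (n := n) (g := fun i => if i is 0 then f else g).
by apply => -[].
Qed.

Lemma recursive_cst n c : recursive n (fun=> c).
Proof.
elim: c => [|c IHc]; first by exists (RZero n).
apply: (@recursive_app1 _ succn) IHc.
by exists RSucc => m /=.
Qed.

(** The step g takes the index, the previous value and the parameters; the
    hypothesis on g reads them in the order in which [RPrec] supplies them. *)
Lemma recursive_primrec n f g m : recursive n f -> recursive n m ->
    recursive n.+2 (fun v => g (nth 0 v 0) (nth 0 v 1) (behead (behead v))) ->
  recursive n (fun v => nat_rect (fun=> nat) (f v) (fun i z => g i z v) (m v)).
Proof.
move=> [ef Hf] cm [eg Hg].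
have cr : recursive n.+1 (fun v => nat_rect (fun=> nat) (f (behead v))
    (fun i z => g i z (behead v)) (nth 0 v 0)).
  exists (RPrec ef eg) => v.
  rewrite /= [thead v](tnth_nth 0)/=.
  elim: (nth 0 v 0) => [|p IHp] /=; first exact: (Hf (behead_tuple v)).
  eexists; first exact: IHp.
  exact: (Hg (cons_tuple p (cons_tuple _ (behead_tuple v)))).
have := recursive_comp cr (n := n) (g := fun i => if i is i'.+1 then nth 0 ^~ i' else m).
move=> [[//|i] ltin|e He]; first exact: recursive_nth.
exists e => v; have := He v; congr eval; rewrite /=.
suff -> : [seq (if i is i'.+1 then (nth 0)^~ i' else m) v | i <- iota 1 n] = v by [].
apply: (@eq_from_nth _ 0) => [|i]; rewrite size_map size_iota ?size_tuple// => ltin.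
by rewrite (nth_map 0) ?size_iota// nth_iota.
Qed.

Lemma recursive_addn n f g : recursive n f -> recursive n g ->
  recursive n (fun v => f v + g v).
Proof.
move=> cf cg.
apply: (recursive_ext (@recursive_primrec _ f (fun _ z _ => z.+1) g cf cg _)) => [|v].
  by apply: (@recursive_app1 _ succn); [exists RSucc|apply: recursive_nth].
by rewrite addnC; elim: (g v) => //= m ->.
Qed.

Lemma recursive_succn n f : recursive n f -> recursive n (fun v => (f v).+1).
Proof. by apply: recursive_app1; exists RSucc. Qed.

Lemma recursive_subn n f g : recursive n f -> recursive n g ->
  recursive n (fun v => f v - g v).
Proof.
have cpred k h : recursive k h -> recursive k (fun v => (h v).-1).
  move=> ch; apply: (recursive_ext (@recursive_primrec _ (fun=> 0) (fun i _ _ => i) h _ ch _)).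
  - exact: recursive_cst.
  - exact: recursive_nth.
  - by move=> v; case: (h v).
move=> cf cg.
apply: (recursive_ext (@recursive_primrec _ f (fun _ z _ => z.-1) g cf cg _)) => [|v].
  by apply: cpred; exact: recursive_nth.
by elim: (g v) => [|m IHm] /=; rewrite ?subn0// IHm subnS.
Qed.

(** Bounded sums give bounded counting and bounded search, so that no further
    recursion has to be programmed except for powers. *)
Lemma recursive_sum n (g : nat -> seq nat -> nat) m : recursive n m ->
    recursive n.+1 (fun v => g (nth 0 v 0) (behead v)) ->
  recursive n (fun v => \sum_(0 <= i < m v) g i v).
Proof.
move=> cm cg.
apply: (recursive_ext (@recursive_primrec _ (fun=> 0) (fun i z v => z + g i v) m _ cm _)).
- exact: recursive_cst.
- apply: recursive_addn; first exact: recursive_nth.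
  have [e He] := cg.
  have := recursive_comp (n := n.+2)
    (g := fun i => if i is i'.+1 then nth 0 ^~ i'.+2 else nth 0 ^~ 0) cg.
  move=> [[|i] ltin|e' He']; [exact: recursive_nth|exact: recursive_nth|].
  exists e' => v; have := He' v; congr eval; rewrite /=; congr g.
  apply: (@eq_from_nth _ 0) => [|i];
    rewrite size_map size_iota ?size_behead ?size_tuple// => ltin.
  by rewrite (nth_map 0) ?size_iota// nth_iota// !nth_behead.
- by move=> v; elim: (m v) => [|k IHk] /=;
  [rewrite big_geq|rewrite big_nat_recr//= IHk].
Qed.

Lemma recursive_muln n f g : recursive n f -> recursive n g ->
  recursive n (fun v => f v * g v).
Proof.
move=> cf cg.
apply: (recursive_ext (@recursive_sum _ (fun _ v => f v) g cg _)) => [|v].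
  exact: recursive_behead cf.
by rewrite sum_nat_const_nat subn0 mulnC.
Qed.

Lemma recursive_expn n f g : recursive n f -> recursive n g ->
  recursive n (fun v => f v ^ g v).
Proof.
move=> cf cg.
apply: (recursive_ext (@recursive_primrec _ (fun=> 1) (fun _ z v => f v * z) g _ cg _)) => [||v].
- exact: recursive_cst.
- apply: recursive_muln; last exact: recursive_nth.
  exact: (@recursive_behead _ (fun v => f (behead v)) (recursive_behead cf)).
- by elim: (g v) => //= m ->; rewrite expnS.
Qed.

Lemma recursive_leq n f g : recursive n f -> recursive n g ->
  recursive n (fun v => f v <= g v).
Proof.
move=> cf cg; apply: recursive_ext (recursive_subn (recursive_cst n 1) (recursive_subn cf cg)) _ => v.
by rewrite -subn_eq0; case: (f v - g v).
Qed.

Lemma recursive_andb n (p q : seq nat -> bool) :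
  recursive n p -> recursive n q -> recursive n (fun v => p v && q v).
Proof. by move=> cp cq; apply: recursive_ext (recursive_muln cp cq) _ => v;
  rewrite mulnb. Qed.

Lemma recursive_eqn n f g : recursive n f -> recursive n g ->
  recursive n (fun v => f v == g v).
Proof.
move=> cf cg; apply: recursive_ext (recursive_andb (recursive_leq cf cg) (recursive_leq cg cf)) _ => v.
by rewrite eqn_leq.
Qed.

Lemma recursive_if n (p : seq nat -> bool) f g : recursive n p -> recursive n f -> recursive n g ->
  recursive n (fun v => if p v then f v else g v).
Proof.
move=> cp cf cg; apply: recursive_ext (recursive_addn (recursive_muln cp cf)
  (recursive_muln (recursive_subn (recursive_cst n 1) cp) cg)) _ => v.
by case: (p v); rewrite ?mul1n ?mul0n ?addn0.
Qed.

(** The quotient is the number of i < f v with (i + 1) * g v <= f v. *)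
Lemma recursive_divn n f g : recursive n f -> recursive n g ->
  recursive n (fun v => f v %/ g v).
Proof.
move=> cf cg.
apply: (recursive_ext (@recursive_sum _
  (fun i v => (0 < g v) && (i.+1 * g v <= f v) : nat) f cf _)) => [|v].
  apply: recursive_andb; first by apply: recursive_leq;
    [exact: recursive_cst|exact: recursive_behead].
  apply: recursive_leq; last exact: recursive_behead.
  apply: recursive_muln; last exact: recursive_behead.
  by apply: recursive_succn; exact: recursive_nth.
case: posnP => [->|g_gt0]; first by rewrite divn0 big1.
have -> : \sum_(0 <= i < f v) (true && (i.+1 * g v <= f v) : nat)
    = \sum_(0 <= i < f v) (i < f v %/ g v).
  by apply: eq_bigr => i _; rewrite -leq_divRL.
have -> : forall p q, \sum_(0 <= i < p) (i < q) = minn p q.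
  move=> p q; elim: p => [|p IHp]; first by rewrite big_geq// min0n.
  by rewrite big_nat_recr//= IHp; lia.
exact/minn_idPr/leq_div.
Qed.

Lemma recursive_odd n f : recursive n f -> recursive n (fun v => odd (f v)).
Proof.
move=> cf; apply: recursive_ext (recursive_subn cf (recursive_muln (recursive_cst n 2)
  (recursive_divn cf (recursive_cst n 2)))) _ => v.
by rewrite divn2 mul2n -[X in X - _]odd_double_half addnK.
Qed.

End TotalFunctions.

(** * Strings as numbers *)

Section BinaryStrings.
Local Open Scope nat_scope.

Fixpoint value (s : bitseq) : nat :=
  if s is b :: s' then b + (value s').*2 else 0.

Definition bitn (k V : nat) : bool := odd (V %/ 2 ^ k).

Fixpoint bits (l x : nat) : bitseq :=
  if l is l'.+1 then odd x :: bits l' x./2 else [::].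

Lemma code_value s : (code s).+1 = 2 ^ size s + value s.
Proof. by elim: s => //= b s; rewrite /code /= expnS; lia. Qed.

Lemma value_lt s : value s < 2 ^ size s.
Proof. by elim: s => //= b s; rewrite expnS; case: b; lia. Qed.

Lemma value_inj s t : size s = size t -> value s = value t -> s = t.
Proof.
elim: s t => [|b s IHs] [|c t]//= [sz] eqv.
by have [-> /IHs -> //] : b = c /\ value s = value t by case: b c eqv => [] []; lia.
Qed.

Lemma code_inj : injective code.
Proof.
elim=> [|b s IHs] [|c t] //=; rewrite /code /=; [lia|lia|].
rewrite -/(code s) -/(code t) => eqc.
have [-> /IHs -> //] : b = c /\ code s = code t by case: b c eqc => [] []; lia.
Qed.

Lemma bitn0 V : bitn 0 V = odd V.
Proof. by rewrite /bitn divn1. Qed.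

Lemma bitnS k V : bitn k.+1 V = bitn k V./2.
Proof. by rewrite /bitn expnS divnMA divn2. Qed.

Lemma bitn_value s k : bitn k (value s) = nth false s k.
Proof.
elim: s k => [|b s IHs] [|k] /=; rewrite ?bitn0 ?bitnS//=.
- by rewrite /bitn div0n.
- by rewrite oddD odd_double oddb addbF.
- by rewrite half_bit_double.
Qed.

Lemma size_bits l x : size (bits l x) = l.
Proof. by elim: l x => //= l IHl x; rewrite IHl. Qed.

Lemma value_bits l x : x < 2 ^ l -> value (bits l x) = x.
Proof.
elim: l x => [|l IHl] x /=; first by case: x.
rewrite expnS => ltx; rewrite IHl; first exact: odd_double_half.
by have := odd_double_half x; lia.
Qed.

(** This closed form of the code of a unary prefix followed by a payload lets the
    decoding machine compare numbers instead of parsing strings. *)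
Lemma code_unary j b :
  (code (nseq j true ++ false :: b)).+2
  = 2 ^ (j + size b).+1 + 2 ^ j * (value b).*2.+1.
Proof.
elim: j => [|j IHj].
  have -> : code (nseq 0 true ++ false :: b) = (code b).*2.+1 by rewrite -addn1.
  have := code_value b; rewrite expnS add0n expn0; lia.
have -> : code (nseq j.+1 true ++ false :: b)
    = (code (nseq j true ++ false :: b)).*2.+2 by rewrite -addn2.
by move: IHj; rewrite addSn !expnS -mulnA; lia.
Qed.

Lemma prefix_unary j j' b b' :
  prefix (nseq j true ++ false :: b) (nseq j' true ++ false :: b') -> j = j'.
Proof. by elim: j j' => [|j IHj] [|j'] //= h; rewrite (IHj _ h). Qed.

Lemma prefix_eq (s t : bitseq) : size s = size t -> prefix s t -> s = t.
Proof.
by move=> sz; rewrite prefixE sz take_size; move/eqP.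
Qed.

Lemma count_iotaS p n : count p (iota 0 n.+1) = count p (iota 0 n) + p n.
Proof. by rewrite -addn1 iotaD count_cat /= add0n addn0. Qed.

Lemma count_iota_lt (p : pred nat) m n :
  p m -> m < n -> count p (iota 0 m) < count p (iota 0 n).
Proof.
move=> pm ltmn.
have : count p (iota 0 n) = count p (iota 0 m.+1) + count p (iota m.+1 (n - m.+1)).
  by rewrite -[in LHS](subnKC ltmn) iotaD count_cat add0n.
by rewrite count_iotaS pm; lia.
Qed.

Lemma count_iota_inj (p : pred nat) m n : p m -> p n ->
  count p (iota 0 m) = count p (iota 0 n) -> m = n.
Proof.
move=> pm pn eqc; case: (ltngtP m n) => // [/(count_iota_lt pm)|/(count_iota_lt pn)];
by rewrite eqc ltnn.
Qed.

Lemma count_iota_double p n :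
  count p (iota 0 n.*2)
  = count (fun i => p i.*2) (iota 0 n) + count (fun i => p i.*2.+1) (iota 0 n).
Proof. by elim: n => // n IHn; rewrite doubleS !count_iotaS IHn; lia. Qed.

End BinaryStrings.

(** * Recursive counting and search *)

Section CountComputable.
Local Open Scope nat_scope.

Lemma recursive_count n (p : nat -> seq nat -> bool) m : recursive n m ->
    recursive n.+1 (fun v => p (nth 0 v 0) (behead v)) ->
  recursive n (fun v => count (p^~ v) (iota 0 (m v))).
Proof.
move=> cm cp; apply: (recursive_ext (@recursive_sum _ (fun i v => p i v : nat) m cm cp)) => v.
elim: (m v) => [|k IHk]; first by rewrite big_geq.
by rewrite big_nat_recr// count_iotaS -IHk.
Qed.

Lemma recursive_has n (p : nat -> seq nat -> bool) m : recursive n m ->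
    recursive n.+1 (fun v => p (nth 0 v 0) (behead v)) ->
  recursive n (fun v => has (p^~ v) (iota 0 (m v))).
Proof.
move=> cm cp.
apply: recursive_ext (recursive_leq (recursive_cst n 1) (recursive_count cm cp)) _ => v.
by rewrite has_count.
Qed.

Lemma recursive_bitn n f g : recursive n f -> recursive n g ->
  recursive n (fun v => bitn (f v) (g v)).
Proof.
by move=> cf cg; apply: recursive_odd; apply: recursive_divn => //;
  apply: recursive_expn => //; exact: recursive_cst.
Qed.

Lemma computable1_of_recursive f : recursive 1 (fun v => f (nth 0 v 0)) ->
  computable1 f.
Proof. by move=> [e He]; exists e => m; exact: He [tuple m]. Qed.

Lemma computable2_of_recursive f :
  recursive 2 (fun v => f (nth 0 v 0) (nth 0 v 1)) -> computable2 f.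
Proof. by move=> [e He]; exists e => m k; exact: He [tuple m; k]. Qed.

End CountComputable.

(** * The maximal inequality for random signs *)

Section MaximalInequality.
Context {R : realDomainType}.
Implicit Types (w : nat -> R) (x T : R) (n V : nat).

(** The signs are read off the binary digits of V, so that V < 2 ^ n runs through
    all sign strings of length n. *)
Definition signed_sum w V n : R :=
  \sum_(0 <= k < n) (if bitn k V then w k else - w k).

Definition exceeds w T n x V : bool :=
  has (fun m => T < `|x + signed_sum w V m|) (iota 0 n.+1).

(** The first sign moves the starting point, and the other signs are the digits
    of [V./2]. *)
Lemma exceedsS w T n x V : exceeds w T n.+1 x V =
  (T < `|x|) ||
  exceeds (w \o succn) T n (x + (if odd V then w 0%N else - w 0%N)) V./2.
Proof.
have eqi : iota 0 n.+2 = [:: 0%N] ++ map succn (iota 0 n.+1).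
  by rewrite -[in LHS]addn1 addnC iotaD add0n -(iotaDl 1 0).
rewrite /exceeds eqi has_cat has_seq1 has_map /signed_sum big_geq// addr0.
congr (_ || _); apply: eq_has => m; rewrite /preim/= big_nat_recl// bitn0 addrA.
by congr (_ < `|_ + _|); apply: eq_bigr => k _; rewrite bitnS.
Qed.

(** Kolmogorov's inequality, with a free starting point x to allow induction on
    the first step. If |x| > T, then T ^ 2 <= x ^ 2 is already enough. Otherwise the
    walks that start with -w 0 and those that start with w 0 are counted apart, and
    (x - w 0) ^ 2 + (x + w 0) ^ 2 = 2 * (x ^ 2 + w 0 ^ 2). *)
Lemma signed_maximal_inequality w T n x : 0 <= T ->
  (count (exceeds w T n x) (iota 0 (2 ^ n)))%:R * T ^+ 2
  <= (2 ^ n)%:R * (x ^+ 2 + \sum_(0 <= k < n) w k ^+ 2).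
Proof.
move=> T0; have big_start N p y w' k : T < `|y| ->
    (count p (iota 0 N))%:R * T ^+ 2
    <= N%:R * (y ^+ 2 + \sum_(0 <= i < k) w' i ^+ 2) :> R.
  move=> ltT; apply: ler_pM; rewrite ?sqr_ge0//.
    by rewrite ler_nat -[leqRHS](size_iota 0) count_size.
  have: T ^+ 2 <= y ^+ 2.
    by rewrite -[leRHS]real_normK ?num_real// lerXn2r ?nnegrE// ltW.
  move=> /le_trans; apply; rewrite lerDl sumr_ge0// => i _; exact: sqr_ge0.
elim: n w x => [|n IHn] w x; case: (ltP T `|x|) => [/big_start//|leT].
  have -> : count (exceeds w T 0 x) (iota 0 (2 ^ 0)) = 0%N.
    by rewrite /= /exceeds /= /signed_sum big_geq// addr0 ltNge leT.
  by rewrite mul0r mul1r addr_ge0 ?sqr_ge0// sumr_ge0// => k _; exact: sqr_ge0.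
have half_count y b : y = x + (if b then w 0%N else - w 0%N) ->
    (count (fun V => exceeds w T n.+1 x (b + V.*2)) (iota 0 (2 ^ n)))%:R * T ^+ 2
    <= (2 ^ n)%:R * (y ^+ 2 + \sum_(1 <= k < n.+1) w k ^+ 2).
  move=> eqy; rewrite big_add1 /=; apply: le_trans (IHn (w \o succn) y).
  rewrite ler_wpM2r ?sqr_ge0// ler_nat sub_count// => V.
  rewrite exceedsS ltNge leT /= half_bit_double eqy.
  by rewrite oddD odd_double addbF oddb.
rewrite expnS mul2n count_iota_double big_ltn// natrD mulrDl -mul2n natrM.
apply: le_trans (lerD (half_count _ false erefl) (half_count _ true erefl)) _.
by rewrite le_eqVlt; apply/orP; left; apply/eqP; ring.
Qed.

End MaximalInequality.

(** * Rare decidable tests and complexity *)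

Lemma K_le U x q : U q = Some x -> (K U x <= size q)%N.
Proof.
move=> Uq; rewrite /K; set S := [set l | _].
have /xgetPex - /(_ 0%N)[_ minl] : exists l, S l; last exact: minl.
have ex : exists l, `[< exists2 p, U p = Some x & size p = l >].
  by exists (size q); apply/asboolP; exists q.
case: (ex_minnP ex) => l /asboolP[p Up sp] minl.
exists l; split; first by exists p.
by move=> r Ur; apply: minl; apply/asboolP; exists r.
Qed.

(** Level j of a test is a decidable set of strings of length len j, given by the
    values of its members, and has density at most 4 ^- j. *)
Section RareTests.
Local Open Scope nat_scope.
Variables (len : nat -> nat) (bad : nat -> nat -> bool).
Hypothesis len_computable : computable1 len.
Hypothesis bad_computable : computable2 (fun j V => bad j V).
Hypothesis len_ge : forall j, 2 * j <= len j.
Hypothesis bad_rare :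
  forall j, count (bad j) (iota 0 (2 ^ len j)) * 4 ^ j <= 2 ^ len j.

Definition rank j V := count (bad j) (iota 0 V).

Definition description j V : bitseq :=
  nseq j true ++ false :: bits (len j - 2 * j) (rank j V).

Lemma size_description j V : size (description j V) + j = (len j).+1.
Proof.
rewrite size_cat size_nseq /= size_bits; have := len_ge j; lia.
Qed.

(** The rank of a member is less than the number of members, which is at most
    2 ^ len j / 4 ^ j. *)
Lemma rank_lt j V : V < 2 ^ len j -> bad j V -> rank j V < 2 ^ (len j - 2 * j).
Proof.
move=> ltV badV; have ltr := count_iota_lt badV ltV.
apply: leq_trans ltr _; have := bad_rare j.
rewrite -[in X in _ <= X -> _](subnK (len_ge j)) expnD expnM.
by rewrite leq_pmul2r// expn_gt0.
Qed.

Lemma code_description j V : V < 2 ^ len j -> bad j V ->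
  (code (description j V)).+2
  = 2 ^ (len j - j).+1 + 2 ^ j * (rank j V).*2.+1.
Proof.
move=> ltV badV; rewrite code_unary size_bits value_bits ?rank_lt//.
by congr (2 ^ _.+1 + _); have := len_ge j; lia.
Qed.

(** The graph, on codes, of the decoding machine: X is the code of the string of
    length len j and value V. *)
Definition describes (P X : nat) : Prop := exists j V,
  [/\ V < 2 ^ len j, bad j V, X.+1 = 2 ^ len j + V & P = code (description j V)].

(** A description that is a prefix of another one has the same unary part, hence
    the same level and the same length; so the two are equal. This gives at once
    prefix-freeness and uniqueness of the decoded string. *)
Lemma description_inj j V j' V' : V < 2 ^ len j -> bad j V ->
    V' < 2 ^ len j' -> bad j' V' -> prefix (description j V) (description j' V') ->
  j = j' /\ V = V'.
Proof.
move=> ltV badV ltV' badV' pre; have eqj := prefix_unary pre; subst j'.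
split=> //; apply: (count_iota_inj badV badV').
have /(prefix_eq _) eqd := pre.
have := eqd; rewrite !size_cat !size_nseq /= !size_bits => /(_ erefl) /eqP.
rewrite eqseq_cat// eqxx /= => /eqP[eqb].
by have := congr1 value eqb; rewrite !value_bits ?rank_lt.
Qed.

Lemma describes_functional P X X' : describes P X -> describes P X' -> X = X'.
Proof.
move=> [j [V [ltV badV eqX eqP]]] [j' [V' [ltV' badV' eqX' eqP']]].
have eqd : description j V = description j' V'.
  by apply: code_inj; rewrite -eqP.
have [|ej eV] := description_inj ltV badV ltV' badV'.
  by rewrite eqd prefix_refl.
by apply: succn_inj; rewrite eqX eqX' ej eV.
Qed.

(** The numerical form of [describes], with V recovered from X and the code of the
    description given by [code_description]. *)
Definition accepts j P X : bool :=
  [&& 2 ^ len j <= X.+1, X.+1 < 2 ^ (len j).+1, bad j (X.+1 - 2 ^ len j) &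
      P.+2 == 2 ^ (len j - j).+1
              + 2 ^ j * (2 * rank j (X.+1 - 2 ^ len j)).+1].

(** The level j may be bounded by the code P, because a description of level j
    begins with j letters 1. *)
Lemma describesP P X :
  reflect (describes P X) (has (fun j => accepts j P X) (iota 0 P.+1)).
Proof.
apply: (iffP hasP) => [[j _ /and4P[ge2 lt2 badV /eqP eqP]]|].
  have ltV : X.+1 - 2 ^ len j < 2 ^ len j by move: lt2; rewrite expnS; lia.
  exists j, (X.+1 - 2 ^ len j); split=> //; first by rewrite subnKC.
  by have := code_description ltV badV; rewrite -mul2n -eqP => -[].
move=> [j [V [ltV badV eqX eqP]]]; exists j.
  have := code_description ltV badV; rewrite -eqP mem_iota /= add0n ltnS.
  have := ltn_expl j (isT : 1 < 2); have := ltn_expl (len j - j) (isT : 1 < 2).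
  rewrite !expnS; lia.
rewrite /accepts eqX leq_addr addKn badV expnS (mul2n (2 ^ len j)) -addnn ltn_add2l ltV.
by rewrite eqP code_description// mul2n eqxx.
Qed.

(** The machine searches for the least X that is described by P; as there is at
    most one, all the smaller candidates fail, as [RMu] requires. *)
Lemma describes_partial_computable : exists e : recf 1,
  forall P X, describes P X <-> eval e [tuple P] X.
Proof.
have clen n f : recursive n f -> recursive n (fun v => len (f v)) by exact: recursive_app1.
have cpow n f : recursive n f -> recursive n (fun v => 2 ^ f v).
  by move=> cf; apply: recursive_expn => //; exact: recursive_cst.
have cbad n f g : recursive n f -> recursive n g -> recursive n (fun v => bad (f v) (g v)).
  exact: (recursive_app2 bad_computable).
have crank n f g : recursive n f -> recursive n g -> recursive n (fun v => rank (f v) (g v)).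
  move=> cf cg; apply: (@recursive_count _ (fun i v => bad (f v) i)) => //.
  by apply: cbad; [exact: recursive_behead|exact: recursive_nth].
have cacc n f g h : recursive n f -> recursive n g -> recursive n h ->
    recursive n (fun v => accepts (f v) (g v) (h v)).
  move=> cf cg ch; have cV : recursive n (fun v => (h v).+1 - 2 ^ len (f v)).
    by apply: recursive_subn; [exact: recursive_succn|exact/cpow/clen].
  apply: recursive_andb; first by apply: recursive_leq;
    [exact/cpow/clen|exact: recursive_succn].
  apply: recursive_andb.
    apply: recursive_leq; first exact/recursive_succn/recursive_succn.
    exact/cpow/recursive_succn/clen.
  apply: recursive_andb; first exact: cbad.
  apply: recursive_eqn; first exact/recursive_succn/recursive_succn.
  apply: recursive_addn.
    by apply/cpow/recursive_succn/recursive_subn => //; exact: clen.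
  apply: recursive_muln; first exact: cpow.
  by apply/recursive_succn/recursive_muln; [exact: recursive_cst|exact: crank].
(* The search argument of [RMu] comes first: entry 0 is X and entry 1 is P. *)
have [e He] : recursive 2 (fun v => 1 - has (fun j => accepts j (nth 0 v 1) (nth 0 v 0))
                                 (iota 0 (nth 0 v 1).+1)).
  apply: recursive_subn; first exact: recursive_cst.
  apply: (@recursive_has _ (fun j v => accepts j (nth 0 v 1) (nth 0 v 0))).
    by apply: recursive_succn; exact: recursive_nth.
  apply: cacc; first exact: recursive_nth.
    exact: (@recursive_behead 2 (fun v => nth 0 v 1) (recursive_nth _)).
  exact: (@recursive_behead 2 (fun v => nth 0 v 0) (recursive_nth _)).
have He' P X : eval e [tuple X; P]
    (1 - has (fun j => accepts j P X) (iota 0 P.+1)) by exact: He [tuple X; P].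
exists (RMu e) => P X /=.
have -> i : cons_tuple i [tuple P] = [tuple i; P] by exact: val_inj.
split=> [dX|[eX _]].
  have /describesP hX := dX; split; first by have := He' P X; rewrite hX.
  move=> i lti; exists 0.
  suff /negPf nacc : ~~ has (fun j => accepts j P i) (iota 0 P.+1).
    by have := He' P i; rewrite nacc.
  apply/describesP => di; have eqi := describes_functional di dX.
  by rewrite eqi ltnn in lti.
apply/describesP; have := eval_functional eX (He' P X).
by case: has.
Qed.

(** A member of level j has complexity at most len j - j + O(1), whereas the
    initial segments of alpha have complexity at least their length minus k. *)
Theorem rare_tests_eventually_pass U alpha : universal_machine U -> KC U alpha ->
  exists J, forall j, J <= j -> ~~ bad j (value (mkseq alpha (len j))).
Proof.
move=> [_ univ] [k Kk].
pose M p := if pselect (exists x, describes (code p) (code x)) is left ex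
  then Some (projT1 (cid ex)) else None.
have MP p x : M p = Some x <-> describes (code p) (code x).
  rewrite /M; case: pselect => [ex|nex]; last first.
    by split=> // d; case: nex; exists x.
  case: (cid ex) => y dy /=; split=> [[<-]//|dx].
  by congr Some; apply: code_inj; exact: describes_functional dy dx.
have Mpf : prefix_free_machine M.
  split.
    have [e He] := describes_partial_computable.
    by exists e => p x; apply: iff_trans (MP p x) (He _ _).
  move=> p q.
  case Mp : (M p) => [x|//] _; case Mq : (M q) => [y|//] _.
  have [j [V [ltV badV _ /code_inj ->]]] := (MP p x).1 Mp.
  have [j' [V' [ltV' badV' _ /code_inj ->]]] := (MP q y).1 Mq.
  by move=> /(description_inj ltV badV ltV' badV')[-> ->].
have [c Mc] := univ M Mpf.
(* c is the cost of simulating M, and the unary part ends with one extra letter. *)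
exists (k + c + 2) => j leJ; apply/negP => badj.
set x := mkseq alpha (len j) in badj.
have szx : size x = len j by rewrite size_mkseq.
have ltx : value x < 2 ^ len j by rewrite -szx value_lt.
have Mx : M (description j (value x)) = Some x.
  by apply/MP; exists j, (value x); split; rewrite ?code_value ?szx.
have [q Uq leq] := Mc _ _ Mx.
have := leq_trans (K_le Uq) leq; have := size_description j (value x).
have := Kk (len j); rewrite -/x; move: (K U x) (size _) => a b.
lia.
Qed.

End RareTests.

(** * Block tests computed from approximations *)

Section BlockTests.
Local Open Scope nat_scope.
Variables (a b c : nat -> nat -> nat) (N : nat -> nat).

(** The summand with i = j puts cut j beyond the index from which the tail is less
    than 1 / (4 * 16 ^ j); the other summands make cut increasing, and the added 2
    gives cut j >= 2 * j, the room needed for a rank of cut j.+1 - 2 j bits. *)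
Definition cut j := \sum_(0 <= i < j.+1) (N (4 * 16 ^ i) + 2).
(** The bound on the integer block sums. As scale j = 2 ^ j * threshold j, it stands for
    2 ^- j. The factor 16 * (cut j.+1).+1 makes all the rounding errors of a block
    together small compared with it. *)
Definition threshold j := 8 ^ j * 16 * (cut j.+1).+1.
Definition scale j := 2 ^ j * threshold j.

(** The integer part of scale j * f k / (c k + 1), where the rational numbers are
    those of precision 1 / scale j; terms before the block are set to 0, so that
    block sums are sums from 0. *)
Definition scaled (f : nat -> nat -> nat) j k :=
  if cut j <= k then scale j * f k (scale j) %/ (c k (scale j)).+1 else 0.

(** Integers are kept as differences of natural numbers: with (f, g) = (a, b) this
    is the positive part of the signed sum, with (f, g) = (b, a) the negative one. *)
Definition split_sum (f g : nat -> nat -> nat) j V m :=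
  \sum_(0 <= k < m) (if bitn k V then scaled f j k else scaled g j k).

(** One of the two truncated differences is 0, so that their sum is the absolute
    value of the partial sum. *)
Definition large_block j V : bool :=
  has (fun m => threshold j < (split_sum a b j V m - split_sum b a j V m)
                        + (split_sum b a j V m - split_sum a b j V m))
      (iota 0 (cut j.+1).+1).

Lemma cutS j : cut j.+1 = cut j + (N (4 * 16 ^ j.+1) + 2).
Proof. by rewrite /cut big_nat_recr. Qed.

Lemma cut_ge j : 2 * j <= cut j.
Proof. by elim: j => [|j IHj]; rewrite ?cutS//; lia. Qed.

Lemma cut_geN j : N (4 * 16 ^ j) <= cut j.
Proof. by case: j => [|j]; rewrite ?cutS /cut ?big_nat1; lia. Qed.

Lemma cut_leS j : cut j <= cut j.+1.
Proof. by rewrite cutS leq_addr. Qed.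

Lemma scaleE j : scale j = 16 ^ j * 16 * (cut j.+1).+1.
Proof. by rewrite /scale /threshold !mulnA -expnMn. Qed.

Lemma threshold_gt0 j : 0 < threshold j.
Proof. by rewrite /threshold !muln_gt0 expn_gt0. Qed.

Lemma scale_gt0 j : 0 < scale j.
Proof. by rewrite /scale muln_gt0 expn_gt0 threshold_gt0. Qed.

Hypotheses (a_computable : computable2 a) (b_computable : computable2 b)
  (c_computable : computable2 c) (N_computable : computable1 N).

Lemma recursive_cut n f : recursive n f -> recursive n (fun v => cut (f v)).
Proof.
move=> cf; apply: (@recursive_sum _ (fun i _ => N (4 * 16 ^ i) + 2)).
  exact: recursive_succn.
apply: recursive_addn; last exact: recursive_cst.
apply: recursive_app1 => //; apply: recursive_muln; first exact: recursive_cst.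
by apply: recursive_expn; [exact: recursive_cst|exact: recursive_nth].
Qed.

Lemma recursive_threshold n f : recursive n f ->
  recursive n (fun v => threshold (f v)).
Proof.
move=> cf; apply: recursive_muln;
  last exact/recursive_succn/recursive_cut/recursive_succn.
apply: recursive_muln; last exact: recursive_cst.
by apply: recursive_expn => //; exact: recursive_cst.
Qed.

Lemma recursive_scaled h n f g : computable2 h -> recursive n f -> recursive n g ->
  recursive n (fun v => scaled h (f v) (g v)).
Proof.
move=> ch cf cg; have cs : recursive n (fun v => scale (f v)).
  apply: recursive_muln; last exact: recursive_threshold.
  by apply: recursive_expn => //; exact: recursive_cst.
apply: recursive_if; last exact: recursive_cst.
  by apply: recursive_leq => //; exact: recursive_cut.
apply: recursive_divn; last by apply: recursive_succn; exact: recursive_app2.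
by apply: recursive_muln => //; exact: recursive_app2.
Qed.

Lemma recursive_split_sum g h n f V m : computable2 g -> computable2 h ->
  recursive n f -> recursive n V -> recursive n m -> recursive n (fun v => split_sum g h (f v) (V v) (m v)).
Proof.
move=> cg ch cf cV cm.
apply: (@recursive_sum _ (fun k v => if bitn k (V v) then _ else _)) => //.
apply: recursive_if; first by apply: recursive_bitn;
  [exact: recursive_nth|exact: recursive_behead].
all: by apply: recursive_scaled => //; [exact: recursive_behead|exact: recursive_nth].
Qed.

Lemma large_block_computable : computable2 (fun j V => large_block j V).
Proof.
apply: (@computable2_of_recursive (fun j V => large_block j V)).
have cj : recursive 3 (fun v => nth 0 (behead v) 0).
  exact: (@recursive_behead 2 (fun v => nth 0 v 0) (recursive_nth _)).
have cV : recursive 3 (fun v => nth 0 (behead v) 1).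
  exact: (@recursive_behead 2 (fun v => nth 0 v 1) (recursive_nth _)).
have cs g h : computable2 g -> computable2 h ->
    recursive 3 (fun v => split_sum g h (nth 0 (behead v) 0) (nth 0 (behead v) 1) (nth 0 v 0)).
  by move=> cg ch; apply: recursive_split_sum => //; exact: recursive_nth.
apply: (@recursive_has _ (fun m v => threshold (nth 0 v 0) <
    (split_sum a b (nth 0 v 0) (nth 0 v 1) m - split_sum b a (nth 0 v 0) (nth 0 v 1) m)
    + (split_sum b a (nth 0 v 0) (nth 0 v 1) m - split_sum a b (nth 0 v 0) (nth 0 v 1) m))).
  exact/recursive_succn/recursive_cut/recursive_succn/recursive_nth.
apply: recursive_leq; first exact/recursive_succn/recursive_threshold.
by apply: recursive_addn; apply: recursive_subn; exact: cs.
Qed.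

Lemma len_computable : computable1 (fun j => cut j.+1).
Proof.
apply: (@computable1_of_recursive (fun j => cut j.+1)).
exact/recursive_cut/recursive_succn/recursive_nth.
Qed.

End BlockTests.

(** * Estimates on the blocks, and convergence *)

Section BlockEstimates.
Variables (R : realType) (a b c : nat -> nat -> nat) (N : nat -> nat) (u : nat -> R).
Hypothesis u_approx : forall k m, (0 < m)%N ->
  `|u k - ((a k m)%:R - (b k m)%:R) / (c k m).+1%:R| < m%:R^-1.
Let sq := series (fun k => u k ^+ 2).
Hypothesis sq_cvg : cvgn sq.
Hypothesis sq_tail : forall m, (0 < m)%N -> `|limn sq - sq (N m)| < m%:R^-1.

Local Notation cut := (cut N).
Local Notation threshold := (threshold N).
Local Notation scale := (scale N).
Local Notation large_block := (large_block a b c N).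

Definition weight j k : R :=
  (scaled c N a j k)%:R - (scaled c N b j k)%:R.

Lemma signed_sum_weight j V m : signed_sum (weight j) V m =
  (split_sum c N a b j V m)%:R - (split_sum c N b a j V m)%:R.
Proof.
rewrite /signed_sum /split_sum !natr_sum -sumrB; apply: eq_bigr => k _.
by case: bitn; rewrite // opprB.
Qed.

Lemma large_blockE j V :
  large_block j V = exceeds (weight j) (threshold j)%:R (cut j.+1) 0 V.
Proof.
apply: eq_has => m; rewrite add0r signed_sum_weight.
move: (split_sum c N a b j V m) (split_sum c N b a j V m) => p q.
rewrite -(ltr_nat R); congr (_ < _); case: (leqP p q) => [lepq|/ltnW leqp].
  by rewrite (eqP lepq) add0n natrB// distrC ger0_norm// subr_ge0 ler_nat.
by rewrite (eqP leqp) addn0 natrB// ger0_norm// subr_ge0 ler_nat.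
Qed.

Lemma floor_approx x y d :
  `|((x %/ d.+1)%:R - (y %/ d.+1)%:R) - (x%:R - y%:R) / d.+1%:R| <= 1 :> R.
Proof.
have fl z : ((z %/ d.+1)%:R : R)  <= (z%:R / d.+1%:R : R) <= (z %/ d.+1)%:R + 1.
  have d0 : 0 < d.+1%:R :> R by rewrite ltr0n.
  apply/andP; split.
    by rewrite ler_pdivlMr// -natrM ler_nat leq_divM.
  by rewrite ler_pdivrMr// natr1 -natrM ler_nat ltnW// ltn_ceil.
have /andP[x1 x2] := fl x; have /andP[y1 y2] := fl y.
move: x1 x2 y1 y2; rewrite mulrBl ler_norml.
move: (x%:R / _) (y%:R / _) => p q; lra.
Qed.

(** One unit of error comes from the approximation of u k, one from rounding. *)
Lemma weight_approx j k : (cut j <= k)%N ->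
  `|weight j k - (scale j)%:R * u k| <= 2.
Proof.
move=> lek; rewrite /weight /scaled lek.
have D0 : 0 < (scale j)%:R :> R by rewrite ltr0n scale_gt0.
have := u_approx k (scale_gt0 N j); move: (scale j) D0 => D D0.
rewrite -(ltr_pM2l D0) mulfV ?gt_eqF// -{1}(gtr0_norm D0) -normrM mulrBr.
have := floor_approx (D * a k D) (D * b k D) (c k D).
rewrite !natrM -[D%:R * _ - D%:R * (b k D)%:R]mulrBr -mulrA !ler_norml ltr_norml.
move: (D%:R * (_ / _)) (D%:R * u k) => p q; lra.
Qed.

Lemma tail_le j m : (cut j <= m)%N ->
  \sum_(cut j <= k < m) u k ^+ 2 <= (4 * 16 ^+ j)^-1.
Proof.
move=> lem; have mono : nondecreasing_seq sq.
  by apply/nondecreasing_seqP => n; rewrite /sq seriesSr lerDl sqr_ge0.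
have := @sq_tail (4 * 16 ^ j)%N; rewrite muln_gt0 expn_gt0 => /(_ isT).
rewrite natrM natrX.
have := mono _ _ (cut_geN N j); have := nondecreasing_cvgn_le mono sq_cvg m.
have -> : \sum_(cut j <= k < m) u k ^+ 2 = sq m - sq (cut j).
  by rewrite /sq sub_series_geq.
rewrite ltr_norml; lra.
Qed.

(** By (D * x + e) ^ 2 <= 2 * D ^ 2 * x ^ 2 + 2 * e ^ 2 with D = scale j and
    |e| <= 2: the tail bound makes the first part at most D ^ 2 / (2 * 16 ^ j), and
    the choice of the scale does the same for the second part. *)
Lemma sum_weight_le j :
  \sum_(0 <= k < cut j.+1) weight j k ^+ 2 <= (scale j)%:R ^+ 2 / 16 ^+ j.
Proof.
rewrite (big_cat_nat (leq0n (cut j)) (cut_leS N j))/= big_nat_cond big1 => [|k];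
  last first.
  rewrite andbT => /andP[_ ltk]; rewrite /weight /scaled leqNgt ltk /=.
  by rewrite subrr expr0n.
have L0 : 0 <= (cut j.+1)%:R :> R by rewrite ler0n.
have t1 : 1 <= 16 ^+ j :> R by rewrite exprn_ege1// ler1n.
rewrite add0r.
have : \sum_(cut j <= k < cut j.+1) weight j k ^+ 2 <=
    \sum_(cut j <= k < cut j.+1) (2 * (scale j)%:R ^+ 2 * u k ^+ 2 + 8).
  rewrite !big_nat; apply: ler_sum => k /andP[lek _].
  have := weight_approx lek; rewrite ler_norml.
  move: (weight j k) (scale j)%:R (u k) => w D x.
  have -> : w = (w - D * x) + D * x by rewrite subrK.
  rewrite addrK; move: (w - D * x) => e /andP[e1 e2].
  have := sqr_ge0 (e - D * x); nra.
move=> /le_trans; apply.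
rewrite big_split/= -mulr_sumr sumr_const_nat -mulr_natr.
have tail := tail_le (cut_leS N j).
have cnt : 8 * (cut j.+1 - cut j)%:R <= (scale j)%:R ^+ 2 / 16 ^+ j / 2 :> R.
  have : (cut j.+1 - cut j)%:R <= (cut j.+1)%:R :> R by rewrite ler_nat leq_subr.
  rewrite scaleE !natrM natrX -[(cut j.+1).+1%:R]natr1.
  move: ((cut j.+1)%:R : R) L0 ((_ - _)%:R : R) (16 ^+ j : R) t1 => L L0 d t t1 dL.
  have t0 : t != 0 by rewrite gt_eqF//; lra.
  have -> : (t * 16 * (L + 1)) ^+ 2 / t / 2 = t * 128 * (L + 1) ^+ 2 by field.
  nra.
have D2 : 0 <= 2 * (scale j)%:R ^+ 2 :> R by rewrite mulr_ge0 ?sqr_ge0.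
have := ler_wpM2l D2 tail; rewrite invfM.
have -> : 2 * (scale j)%:R ^+ 2 * (4^-1 * (16 ^+ j)^-1)
   = (scale j)%:R ^+ 2 / 16 ^+ j / 2 :> R by field; rewrite gt_eqF; lra.
lra.
Qed.

(** The maximal inequality bounds the density by the sum of squares divided by
    threshold j ^ 2, that is by 4 ^ j / 16 ^ j. *)
Lemma large_block_rare j :
  (count (large_block j) (iota 0 (2 ^ cut j.+1)) * 4 ^ j <= 2 ^ cut j.+1)%N.
Proof.
have T0 : 0 < (threshold j)%:R :> R by rewrite ltr0n threshold_gt0.
have := signed_maximal_inequality (weight j) (cut j.+1) 0 (ltW T0).
rewrite -(eq_count (large_blockE j)) expr0n add0r => max_le.
have := le_trans max_le (ler_wpM2l (ler0n _ _) (sum_weight_le j)).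
have -> : (scale j)%:R ^+ 2 / 16 ^+ j = (4 ^+ j)^-1 * (threshold j)%:R ^+ 2 :> R.
  have -> : (16 : R) = 4 * 4 by ring.
  rewrite /scale natrM natrX exprMn -exprM mulnC exprM (_ : 2 ^+ 2 = 4 :> R).
    by rewrite exprMn; field; rewrite expf_neq0.
  by ring.
rewrite [leRHS]mulrA ler_pM2r ?exprn_gt0// ler_pdivlMr ?exprn_gt0//.
by rewrite -(ler_nat R) natrM !natrX.
Qed.

Variable alpha : nat -> bool.
Let eps k : R := if alpha k then 1 else -1.
Let S := series (fun k => eps k * u k).

(** After division by the scale, the test accounts for 2 ^- j and the rounding
    errors, 2 at each index, for at most another 2 ^- j. *)
Lemma block_small j m : (cut j <= m <= cut j.+1)%N ->
    ~~ large_block j (value (mkseq alpha (cut j.+1))) ->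
  `|S m - S (cut j)| <= 2 / 2 ^+ j.
Proof.
move=> /andP[lem lem']; rewrite large_blockE => /hasPn/(_ m).
rewrite mem_iota /= add0n ltnS => /(_ lem'); rewrite -leNgt add0r => small.
have D0 : 0 < (scale j)%:R :> R by rewrite ltr0n scale_gt0.
have -> : S m - S (cut j) = \sum_(cut j <= k < m) eps k * u k.
  by rewrite /S sub_series_geq.
have eqs : signed_sum (weight j) (value (mkseq alpha (cut j.+1))) m
    = \sum_(cut j <= k < m) eps k * weight j k.
  rewrite /signed_sum (big_cat_nat (leq0n (cut j)) lem)/=.
  rewrite big_nat_cond big1 ?add0r => [|k]; last first.
    rewrite andbT => /andP[_ ltk]; rewrite /weight /scaled leqNgt ltk /=.
    by rewrite subrr oppr0 if_same.
  rewrite !big_nat; apply: eq_bigr => k /andP[_ ltk].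
  rewrite bitn_value nth_mkseq ?(leq_trans ltk)// /eps.
  by case: (alpha k); rewrite ?mul1r ?mulN1r.
rewrite {}eqs in small.
have err : `|\sum_(cut j <= k < m) eps k * weight j k
    - (scale j)%:R * \sum_(cut j <= k < m) eps k * u k| <= 2 * (cut j.+1)%:R.
  rewrite mulr_sumr -sumrB; apply: le_trans (ler_norm_sum _ _ _) _.
  apply: (@le_trans _ _ (\sum_(cut j <= k < m) 2)).
    rewrite !big_nat; apply: ler_sum => k /andP[lek _].
    rewrite mulrCA -mulrBr normrM.
    have -> : `|eps k| = 1 by rewrite /eps; case: (alpha k); rewrite ?normrN normr1.
    by rewrite mul1r weight_approx.
  rewrite sumr_const_nat -[leLHS]mulr_natr ler_pM2l// ler_nat.
  exact: leq_trans (leq_subr _ _) lem'.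
have thresholdE : (threshold j)%:R = (scale j)%:R / 2 ^+ j :> R.
  by rewrite /scale natrM natrX mulrC mulKf// expf_neq0.
have le2 : 2 * (cut j.+1)%:R <= (threshold j)%:R :> R.
  rewrite -natrM ler_nat /threshold; have := expn_gt0 8 j; nia.
rewrite -(ler_pM2l D0) -{1}(gtr0_norm D0) -normrM mulrCA -thresholdE.
move: small err; rewrite !ler_norml; lra.
Qed.

(** The geometric series of the block bounds, in the form
    4 / 2 ^ j.+1 + 2 / 2 ^ j = 4 / 2 ^ j. *)
Lemma series_close J j m :
    (forall i, (J <= i)%N -> ~~ large_block i (value (mkseq alpha (cut i.+1)))) ->
    (J <= j)%N -> (cut j <= m)%N ->
  `|S m - S (cut j)| <= 4 / 2 ^+ j.
Proof.
move=> good.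
have : (m <= cut (j + m))%N by have := cut_ge N (j + m); lia.
move: {2}m => i; elim: i j => [|i IHi] j.
  rewrite addn0 => le1 leJ le2; have -> : m = cut j by apply/eqP; rewrite eqn_leq le1.
  by rewrite subrr normr0 divr_ge0// exprn_ge0.
rewrite addnS -addSn => lem leJ lejm.
have pow0 : 0 < (2 ^+ j)^-1 :> R by rewrite invr_gt0 exprn_gt0.
have [lem'|/ltnW lem'] := leqP m (cut j.+1).
  have inj : (cut j <= m <= cut j.+1)%N by rewrite lejm.
  by apply: le_trans (block_small inj (good _ leJ)) _; rewrite ler_pM2r// ler_nat.
have endj : (cut j <= cut j.+1 <= cut j.+1)%N by rewrite cut_leS leqnn.
have h1 := block_small endj (good _ leJ).
have h2 := IHi j.+1 lem (leq_trans leJ (leqnSn _)) lem'.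
rewrite -(subrK (S (cut j.+1)) (S m)) -addrA.
apply: le_trans (ler_normD _ _) _; apply: le_trans (lerD h2 h1) _.
rewrite exprS invfM; lra.
Qed.

Lemma signed_series_cvg J :
    (forall i, (J <= i)%N -> ~~ large_block i (value (mkseq alpha (cut i.+1)))) ->
  cvgn S.
Proof.
move=> good; apply: cauchy_cvg; apply: cauchy_exP => e e0.
have [j leJ ltj] : exists2 j, (J <= j)%N & 4 / 2 ^+ j < e.
  set n := (Num.trunc (4 / e)).+1; exists (J + n)%N; first exact: leq_addr.
  rewrite ltr_pdivrMr ?exprn_gt0// mulrC -ltr_pdivrMr// -natrX.
  apply: lt_le_trans (truncnS_gt _) _; rewrite ler_nat -/n.
  exact: leq_trans (ltnW (ltn_expl n (isT : 1 < 2)%N)) (leq_pexp2l _ (leq_addl _ _)).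
exists (S (cut j)); exists (cut j) => // m /= lem.
rewrite -ball_normE /= distrC; exact: le_lt_trans (series_close good leJ lem) ltj.
Qed.

End BlockEstimates.
Theorem theorem2p3 (R : realType) (U : bitseq -> option bitseq)
    (hU : universal_machine U) (u eps : nat -> R)
    (hu : square_computable u) (heps : random_rademacher U eps) :
  cvgn (series (fun n => eps n * u n)).
Proof.
have [[q [a [b [c [ca cb cc qE]]]] uq] sq_cvg [N cN sq_tail]] := hu.
have [alpha KCa epsE] := heps.
have u_approx k m : (0 < m)%N ->
    `|u k - ((a k m)%:R - (b k m)%:R) / (c k m).+1%:R| < m%:R^-1.
  by move=> /(uq k); rewrite qE fmorph_div rmorphB/= !ratr_nat.
have [J good] := rare_tests_eventually_pass (len_computable cN)
  (large_block_computable ca cb cc cN)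
  (fun j => leq_trans (cut_ge N j) (cut_leS N j))
  (large_block_rare u_approx sq_cvg sq_tail) hU KCa.
have := signed_series_cvg u_approx good.
by under [X in series X]eq_fun do rewrite -epsE.
Qed.
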